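(* The variety of AG-groups, the variety of AG$^{**}$-quasigroups and the variety of $\mathbb{Z}[x]/(x^2-1)$-modules are (pairwise) term equivalent.
   Context: All identities are universally quantified, all algebras have nonempty underlying sets, and juxtaposition binds more strongly than $\cdot$ (so $ab\cdot c=(a\cdot b)\cdot c$ and $a\cdot bc=a\cdot(b\cdot c)$). The variety of AG-groups is the variety of algebras $(G,\cdot,{}^{-1},e)$ (with operations of arities $2,1,0$) satisfying the identities $$ab\cdot c=cb\cdot a,\quad aa^{-1}=a^{-1}a=e,\quad ea=a.$$ The variety of AG$^{**}$-quasigroups is the variety of algebras $(G,\cdot,/,\backslash)$ (three binary operations) satisfying the identities $$ab\cdot c=cb\cdot a,\quad a\cdot bc=b\cdot ac,\quad a\cdot(a\backslash b)=a\backslash(a\cdot b)=(b/a)\cdot a=(b\cdot a)/a=b.$$ The variety of $\mathbb{Z}[x]/(x^2-1)$-modules is the variety of algebras $(G,+,-,0,\varphi)$ (arities $2,1,0,1$) such that $(G,+,-,0)$ is an abelian group and $$\varphi(a+b)=\varphi(a)+\varphi(b),\quad \varphi(\varphi(a))=a.$$ (The action of $x$ is given by the involutory automorphism $\varphi$.) Two varieties $\mathcal V,\mathcal W$ are term equivalent if each basic operation of $\mathcal W$ can be assigned a term in the language of $\mathcal V$, and each basic operation of $\mathcal V$ a term in the language of $\mathcal W$, so that interpreting these terms turns every algebra of $\mathcal V$ into an algebra of $\mathcal W$ on the same underlying set and vice versa, and the two resulting translations are mutually inverse. A nullary operation (constant) may be assigned a term in one variable that is constant in every algebra of the other variety, i.e.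 whose value does not depend on the variable. *)

(* Defs.v *)
From mathcomp Require Import all_boot.

Set Implicit Arguments.
Unset Strict Implicit.
Unset Printing Implicit Defensive.

(** * Universal algebra: signatures, terms, varieties *)

Record signature := Signature { op : Type; arity : op -> nat }.

Inductive term (S : signature) (X : Type) : Type :=
| Var of X
| App (f : op S) of 'I_(arity f) -> term S X.

Arguments Var {S X} _.
Arguments App {S X} f _.

Definition app (S : signature) (X : Type) (f : op S)
  (args : (arity f).-tuple (term S X)) : term S X := App f (tnth args).

Arguments app {S X} f args.

(** An algebra of signature [S] is a pair of an underlying type [G] and an
    element of [operations S G].  The two are kept apart so that algebras of
    different signatures can share the same [G]. *)
Definition operations (S : signature) (G : Type) : Type :=
  forall f : op S, ('I_(arity f) -> G) -> G.

Fixpoint eval (S : signature) (G : Type) (A : operations S G)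
  (X : Type) (v : X -> G) (t : term S X) : G :=
  match t with
  | Var x => v x
  | App f args => A f (fun i => eval A v (args i))
  end.

Record variety := Variety {
  sig :> signature;
  identity : term sig nat -> term sig nat -> Prop }.

(** Nonemptiness of [G] is not part of [satisfies]; it is assumed separately
    wherever algebras are quantified over. *)
Definition satisfies (V : variety) (G : Type) (A : operations V G) : Prop :=
  forall s t : term V nat, identity s t ->
  forall v : nat -> G, eval A v s = eval A v t.

(** * Term equivalence *)

(** Each operation of [W] of arity [n > 0] is assigned an [n]-ary term of [V],
    and each nullary one a term in one variable; a closed term is the special
    case where that variable does not occur. *)
Definition translation (V W : signature) : Type :=
  forall g : op W, term V 'I_(maxn 1 (arity g)).

(** [B] is obtained from [A] by interpreting the terms [tau].  For nullary [g]
    the valuation [v] restricts to the empty tuple of arguments, so the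
    equation says that the one-variable term [tau g] is constant in [A], with
    value the constant [g] of [B].  On a nonempty [G], [tau] and [A] determine
    [B], at every tuple of arguments. *)
Definition interpreted_by (V W : signature) (tau : translation V W) (G : Type)
  (A : operations V G) (B : operations W G) : Prop :=
  forall (g : op W) (v : 'I_(maxn 1 (arity g)) -> G),
    B g (fun i => v (widen_ord (leq_maxr 1 (arity g)) i)) = eval A v (tau g).

Definition turns_into (V W : variety) (tau : translation V W) : Prop :=
  forall G : Type, inhabited G ->
  forall A : operations V G, satisfies A ->
  exists2 B : operations W G, interpreted_by tau A B & satisfies B.

Definition left_inverse_translation (V W : variety)
  (tau : translation V W) (sigma : translation W V) : Prop :=
  forall G : Type, inhabited G ->
  forall (A : operations V G) (B : operations W G),
  satisfies A -> interpreted_by tau A B -> interpreted_by sigma B A.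

Definition term_equivalent (V W : variety) : Prop :=
  exists (tau : translation V W) (sigma : translation W V),
    [/\ turns_into tau, turns_into sigma,
        left_inverse_translation tau sigma &
        left_inverse_translation sigma tau].

(** * The three varieties *)

Module AGGroup.

Inductive ops : Type := Mul | Inv | E.

Definition S : signature :=
  Signature (fun f : ops => match f with Mul => 2 | Inv => 1 | E => 0 end).

Notation T := (term S nat).

Definition mul (s t : T) : T := @app S nat Mul [tuple s; t].
Definition inv (s : T) : T := @app S nat Inv [tuple s].
Definition e : T := @app S nat E [tuple].
Definition a : T := Var 0.
Definition b : T := Var 1.
Definition c : T := Var 2.

Inductive ids : T -> T -> Prop :=
| left_invertive : ids (mul (mul a b) c) (mul (mul c b) a)
| mul_inv_r : ids (mul a (inv a)) e
| mul_inv_l : ids (mul (inv a) a) e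
| mul_e_l : ids (mul e a) a.

End AGGroup.

Definition AG_groups : variety := Variety AGGroup.ids.

Module AGssQuasigroup.

Inductive ops : Type := Mul | RDiv | LDiv.

Definition S : signature := Signature (fun _ : ops => 2).

Notation T := (term S nat).

Definition mul (s t : T) : T := @app S nat Mul [tuple s; t].
(** [rdiv s t] is s / t and [ldiv s t] is s \ t. *)
Definition rdiv (s t : T) : T := @app S nat RDiv [tuple s; t].
Definition ldiv (s t : T) : T := @app S nat LDiv [tuple s; t].
Definition a : T := Var 0.
Definition b : T := Var 1.
Definition c : T := Var 2.

Inductive ids : T -> T -> Prop :=
| left_invertive : ids (mul (mul a b) c) (mul (mul c b) a)
| ag_star_star : ids (mul a (mul b c)) (mul b (mul a c))
| mul_ldiv : ids (mul a (ldiv a b)) b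
| ldiv_mul : ids (ldiv a (mul a b)) b
| rdiv_mul : ids (mul (rdiv b a) a) b
| mul_rdiv : ids (rdiv (mul b a) a) b.

End AGssQuasigroup.

Definition AGss_quasigroups : variety := Variety AGssQuasigroup.ids.

Module InvolutoryModule.

Inductive ops : Type := Add | Opp | Zero | Phi.

Definition S : signature :=
  Signature (fun f : ops =>
    match f with Add => 2 | Opp => 1 | Zero => 0 | Phi => 1 end).

Notation T := (term S nat).

Definition add (s t : T) : T := @app S nat Add [tuple s; t].
Definition opp (s : T) : T := @app S nat Opp [tuple s].
Definition zero : T := @app S nat Zero [tuple].
Definition phi (s : T) : T := @app S nat Phi [tuple s].
Definition a : T := Var 0.
Definition b : T := Var 1.
Definition c : T := Var 2.

Inductive ids : T -> T -> Prop :=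
| addA : ids (add a (add b c)) (add (add a b) c)
| addC : ids (add a b) (add b a)
| add0 : ids (add zero a) a
| addN : ids (add (opp a) a) zero
| phiD : ids (phi (add a b)) (add (phi a) (phi b))
| phiK : ids (phi (phi a)) a.

End InvolutoryModule.

(** Modules over Z[x]/(x^2 - 1), with [phi] the action of x. *)
Definition Zx_x2m1_modules : variety := Variety InvolutoryModule.ids.

(* Main.v *)
From Stdlib Require Import FunctionalExtensionality.
From mathcomp Require Import all_boot.
Require Import Defs.

Set Implicit Arguments.
Unset Strict Implicit.
Unset Printing Implicit Defensive.

(** AG-groups serve as the hub, the third equivalence being obtained by
    composing translations.  In an AG-group, [(x e) e = x], so [x |-> x e] is
    an involution [phi], and [x + y := (x e) y] is an abelian group operation
    with zero [e] and opposite [(x e)^-1], preserved by [phi]; conversely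
    [x y = phi x + y] and [x^-1 = - phi x].  In an AG**-quasigroup, [x / x] is
    a left unit not depending on [x]: by [y (z x) = z (y x)], a fixed point [x]
    of the left translation by [y] yields the fixed points [z x], i.e. all
    elements. *)

(** * Composition of translations *)

Fixpoint subst (S : signature) (X Y : Type) (s : X -> term S Y)
  (t : term S X) : term S Y :=
  match t with
  | Var x => s x
  | App f args => App f (fun i => subst s (args i))
  end.

Lemma eval_subst (S : signature) (G : Type) (A : operations S G) (X Y : Type)
    (s : X -> term S Y) (v : Y -> G) (t : term S X) :
  eval A v (subst s t) = eval A (fun x => eval A v (s x)) t.
Proof.
elim: t => [//|f args IH] /=.
by congr (A f _); apply: functional_extensionality => i.
Qed.

(** The value [y] is reached only when [n = 0], where [maxn 1 n] still provides one index. *)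
Definition pad (T : Type) (n : nat) (y : T) (args : 'I_n -> T) :
  'I_(maxn 1 n) -> T := fun i => oapp args y (insub (val i)).

Lemma pad_widen (T : Type) (n : nat) (y : T) (args : 'I_n -> T) (i : 'I_n) :
  pad y args (widen_ord (leq_maxr 1 n) i) = args i.
Proof.
rewrite /pad /=; case: insubP => [j _ jE|]; last by rewrite ltn_ord.
by congr args; apply: val_inj.
Qed.

(** [x] fills the dummy variable of the terms assigned to constants. *)
Fixpoint translate (V W : signature) (tau : translation V W) (X : Type) (x : X)
  (t : term W X) : term V X :=
  match t with
  | Var y => Var y
  | App g args => subst (pad (Var x) (fun i => translate tau x (args i))) (tau g)
  end.

(** The choice of [x] does not matter: [interpreted_by] already forces the terms assigned to
    constants to be constant in [A]. *)
Lemma eval_translate (V W : signature) (tau : translation V W) (G : Type)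
    (A : operations V G) (B : operations W G) (X : Type) (x : X) (v : X -> G)
    (t : term W X) :
  interpreted_by tau A B -> eval A v (translate tau x t) = eval B v t.
Proof.
move=> tauAB; elim: t => [//|g args IH] /=.
rewrite eval_subst -tauAB; congr (B g _).
by apply: functional_extensionality => i; rewrite pad_widen IH.
Qed.

(** Index 0 lies in ['I_(maxn 1 n)] for every [n], so it can always serve as the dummy variable. *)
Definition comp_translation (V W U : signature) (tau : translation V W)
  (rho : translation W U) : translation V U :=
  fun g => translate tau (Ordinal (leq_maxl 1 (arity g))) (rho g).

Lemma interpreted_by_comp (V W U : signature) (tau : translation V W)
    (rho : translation W U) (G : Type) (A : operations V G)
    (B : operations W G) (C : operations U G) :
  interpreted_by tau A B ->
  interpreted_by (comp_translation tau rho) A C <-> interpreted_by rho B C.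
Proof.
by move=> tauAB; split=> H g v; rewrite H (eval_translate _ _ _ tauAB).
Qed.

Lemma turns_into_comp (V W U : variety) (tau : translation V W)
    (rho : translation W U) :
  turns_into tau -> turns_into rho -> turns_into (comp_translation tau rho).
Proof.
move=> Htau Hrho G G0 A satA.
have [B tauAB satB] := Htau G G0 A satA.
have [C rhoBC satC] := Hrho G G0 B satB.
by exists C => //; apply/(interpreted_by_comp rho C tauAB).
Qed.

Lemma left_inverse_comp (V W U : variety) (tau : translation V W)
    (sigma : translation W V) (rho : translation W U) (pi : translation U W) :
  turns_into tau ->
  left_inverse_translation tau sigma -> left_inverse_translation rho pi ->
  left_inverse_translation (comp_translation tau rho) (comp_translation pi sigma).
Proof.
move=> Htau Hsigma Hpi G G0 A C satA H.
(* The hypothesis [H] relates only [A] and [C]; the intermediate algebra has to be rebuilt from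
   [A]. *)
have [B tauAB satB] := Htau G G0 A satA.
have rhoBC := (interpreted_by_comp rho C tauAB).1 H.
apply/(interpreted_by_comp sigma A (Hpi G G0 B C satB rhoBC)).
exact: Hsigma tauAB.
Qed.

Lemma term_equivalent_sym (V W : variety) :
  term_equivalent V W -> term_equivalent W V.
Proof. by case=> tau [sigma []]; exists sigma, tau. Qed.

Lemma term_equivalent_trans (V W U : variety) :
  term_equivalent V W -> term_equivalent W U -> term_equivalent V U.
Proof.
move=> [tau [sigma [Ht Hs Hts Hst]]] [rho [pi [Hr Hp Hrp Hpr]]].
exists (comp_translation tau rho), (comp_translation pi sigma).
by split; [apply: turns_into_comp|apply: turns_into_comp
          |apply: left_inverse_comp|apply: left_inverse_comp].
Qed.

(** * The three kinds of algebras *)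

Record is_AG_group (G : Type) (mul : G -> G -> G) (inv : G -> G) (e : G) : Prop :=
  IsAGGroup {
    ag_left_invertive : forall a b c, mul (mul a b) c = mul (mul c b) a;
    ag_mulxV : forall a, mul a (inv a) = e;
    ag_mulVx : forall a, mul (inv a) a = e;
    ag_mul1x : forall a, mul e a = a }.

Record is_AGss_quasigroup (G : Type) (mul rdiv ldiv : G -> G -> G) : Prop :=
  IsAGssQuasigroup {
    q_left_invertive : forall a b c, mul (mul a b) c = mul (mul c b) a;
    q_mulCA : forall a b c, mul a (mul b c) = mul b (mul a c);
    q_mul_ldiv : forall a b, mul a (ldiv a b) = b;
    q_ldiv_mul : forall a b, ldiv a (mul a b) = b;
    q_rdiv_mul : forall a b, mul (rdiv b a) a = b;
    q_mul_rdiv : forall a b, rdiv (mul b a) a = b }.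

Record is_involutory_module (G : Type) (add : G -> G -> G) (opp : G -> G)
  (zero : G) (phi : G -> G) : Prop := IsInvolutoryModule {
    m_addA : forall a b c, add a (add b c) = add (add a b) c;
    m_addC : forall a b, add a b = add b a;
    m_add0 : forall a, add zero a = a;
    m_addN : forall a, add (opp a) a = zero;
    m_phiD : forall a b, phi (add a b) = add (phi a) (phi b);
    m_phiK : forall a, phi (phi a) = a }.

(** * From AG-groups to quasigroups and modules *)

Section AGGroupTheory.
Variables (G : Type) (mul : G -> G -> G) (inv : G -> G) (e : G).
Hypothesis AG : is_AG_group mul inv e.
Local Notation "x * y" := (mul x y).

Let li a b c : (a * b) * c = (c * b) * a. Proof. exact: ag_left_invertive AG _ _ _. Qed.
Let mul1 a : e * a = a. Proof. exact: ag_mul1x AG a. Qed.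

(** Left invertivity three times: [(ab)(cd) = ((cd)b)a = ((bd)c)a = (ac)(bd)]. *)
Lemma ag_medial a b c d : (a * b) * (c * d) = (a * c) * (b * d).
Proof. by rewrite li (li c d b) (li _ c a). Qed.

(** The medial law applied to [(ea)(bc)]. *)
Lemma ag_mulCA a b c : a * (b * c) = b * (a * c).
Proof. by rewrite -{1}(mul1 a) ag_medial mul1. Qed.

Lemma ag_mulxx1 a : (a * e) * e = a.
Proof. by rewrite li !mul1. Qed.

Lemma ag_mulVK a b : (b * inv a) * a = b.
Proof. by rewrite li (ag_mulxV AG) mul1. Qed.

Lemma ag_mulKV a b : (b * a) * inv a = b.
Proof. by rewrite li (ag_mulVx AG) mul1. Qed.

(** This makes [inv a * e] the left divisor by [a]: the product turns into [((ab)e) * inv a], and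
    [(ab)e = ba]. *)
Lemma ag_V1_mulK a b : (inv a * e) * (a * b) = b.
Proof. by rewrite li (li a b e) mul1 ag_mulKV. Qed.

Lemma AGss_quasigroup_of_AG_group :
  is_AGss_quasigroup mul (fun a b => a * inv b) (fun a b => (inv a * e) * b).
Proof.
split=> [||a b|||]; [exact: li|exact: ag_mulCA| |exact: ag_V1_mulK
                    |exact: ag_mulVK|exact: ag_mulKV].
(* Left multiplications commute, so the one-sided cancellation also holds in the other order. *)
by rewrite ag_mulCA ag_V1_mulK.
Qed.

Lemma involutory_module_of_AG_group :
  is_involutory_module (fun a b => (a * e) * b) (fun a => inv (a * e)) e
    (fun a => a * e).
Proof.
split=> [a b c|a b|a|a|a b|a]; last exact: ag_mulxx1.
(* Associativity: the sides become [(c(be))a] and [(b(ae))c], and both are then brought to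
   [(b(ce))a]. *)
- rewrite [LHS]li (li (b * e) c e) mul1 [in RHS](li (a * e) b e) mul1.
  by rewrite [RHS]li (ag_mulCA c a e) [RHS]li (ag_mulCA c b e).
- exact: li.
- by rewrite !mul1.
- by rewrite li (ag_mulxV AG).
(* Both sides become [a(be)]. *)
- by rewrite li mul1 ag_mulxx1 ag_mulCA.
Qed.

End AGGroupTheory.

(** * From quasigroups to AG-groups *)

Section AGssQuasigroupTheory.
Variables (G : Type) (mul rdiv ldiv : G -> G -> G).
Hypothesis Q : is_AGss_quasigroup mul rdiv ldiv.
Local Notation "x * y" := (mul x y).
Local Notation "x / y" := (rdiv x y).

Lemma q_mul_divxx a b : (a / a) * b = b.
Proof. by rewrite -(q_rdiv_mul Q a b) (q_mulCA Q) (q_rdiv_mul Q a a). Qed.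

(** Since [a / a] fixes [b] from the left, dividing by [b] on the right gives it back as [b / b]. *)
Lemma q_divxx a b : a / a = b / b.
Proof. by rewrite -[LHS](q_mul_rdiv Q b) q_mul_divxx. Qed.

Lemma AG_group_of_AGss_quasigroup x :
  is_AG_group mul (fun a => (a / a) / a) (x / x).
Proof.
split=> [|a|a|a]; first exact: q_left_invertive Q.
(* With [u = x / x], left invertivity turns [(ua)((a/a)/a)] into [(((a/a)/a)a)u = (a/a)u = u]. *)
- rewrite -{1}(q_mul_divxx x a) (q_left_invertive Q) (q_rdiv_mul Q).
  by rewrite q_mul_divxx.
- by rewrite (q_rdiv_mul Q) (q_divxx a x).
- exact: q_mul_divxx.
Qed.

End AGssQuasigroupTheory.

(** * From modules to AG-groups *)

Section InvolutoryModuleTheory.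
Variables (G : Type) (add : G -> G -> G) (opp : G -> G) (zero : G) (phi : G -> G).
Hypothesis M : is_involutory_module add opp zero phi.
Local Notation "x + y" := (add x y).

Lemma m_addx0 a : a + zero = a.
Proof. by rewrite (m_addC M) (m_add0 M). Qed.

Lemma m_addrN a : a + opp a = zero.
Proof. by rewrite (m_addC M) (m_addN M). Qed.

Lemma m_addI a b c : a + b = a + c -> b = c.
Proof.
by move=> H; rewrite -(m_add0 M b) -(m_addN M a) -(m_addA M) H (m_addA M)
  (m_addN M) (m_add0 M).
Qed.

Lemma m_phi0 : phi zero = zero.
Proof. by apply: (@m_addI (phi zero)); rewrite -(m_phiD M) !m_addx0. Qed.

Lemma AG_group_of_involutory_module :
  is_AG_group (fun a b => phi a + b) (fun a => opp (phi a)) zero.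
Proof.
split=> [a b c|a|a|a].
(* The product [(ab)c] expands to [a + phi b + c], which is symmetric in [a] and [c]. *)
- rewrite !(m_phiD M) !(m_phiK M) (m_addC M (a + _)) (m_addA M).
  by rewrite (m_addC M c a) -!(m_addA M) (m_addC M _ a) (m_addA M) (m_addC M _ c)
    (m_addA M).
- exact: m_addrN.
(* Writing the last [a] as [phi (phi a)] puts the whole sum under one [phi]. *)
- rewrite -{2}(m_phiK M a) -(m_phiD M) (m_addN M); exact: m_phi0.
- by rewrite m_phi0 (m_add0 M).
Qed.

End InvolutoryModuleTheory.

(** * Algebras over the three signatures in curried form *)

Definition AG_ops (G : Type) (mul : G -> G -> G) (inv : G -> G) (e : G) :
  operations AG_groups G :=
  fun f => match f return ('I_(@arity AGGroup.S f) -> G) -> G with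
  | AGGroup.Mul => fun v => mul (v ord0) (v ord_max)
  | AGGroup.Inv => fun v => inv (v ord0)
  | AGGroup.E => fun=> e
  end.

Definition Q_ops (G : Type) (mul rdiv ldiv : G -> G -> G) :
  operations AGss_quasigroups G :=
  fun f => match f return ('I_(@arity AGssQuasigroup.S f) -> G) -> G with
  | AGssQuasigroup.Mul => fun v => mul (v ord0) (v ord_max)
  | AGssQuasigroup.RDiv => fun v => rdiv (v ord0) (v ord_max)
  | AGssQuasigroup.LDiv => fun v => ldiv (v ord0) (v ord_max)
  end.

Definition M_ops (G : Type) (add : G -> G -> G) (opp : G -> G) (zero : G)
  (phi : G -> G) : operations Zx_x2m1_modules G :=
  fun f => match f return ('I_(@arity InvolutoryModule.S f) -> G) -> G with
  | InvolutoryModule.Add => fun v => add (v ord0) (v ord_max)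
  | InvolutoryModule.Opp => fun v => opp (v ord0)
  | InvolutoryModule.Zero => fun=> zero
  | InvolutoryModule.Phi => fun v => phi (v ord0)
  end.

Definition pair_fun (G : Type) (x y : G) : 'I_2 -> G :=
  fun i => if val i is 0 then x else y.

Lemma pair_funE (G : Type) (v : 'I_2 -> G) : v = pair_fun (v ord0) (v ord_max).
Proof.
apply: functional_extensionality => -[[|[|//]] lti]; rewrite /pair_fun /=;
  by congr v; apply: val_inj.
Qed.

Lemma const_funE (G : Type) (v : 'I_1 -> G) : v = fun=> v ord0.
Proof. by apply: functional_extensionality => i; rewrite ord1. Qed.

Lemma empty_funE (G : Type) (v w : 'I_0 -> G) : v = w.
Proof. by apply: functional_extensionality => -[]. Qed.

(** By extensionality an operation is determined by its values on the standard tuples; [fun=> g0]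
    stands for the empty tuple. *)
Lemma AG_opsP (G : Type) (g0 : G) (A : operations AG_groups G) :
  exists mul inv e, A = AG_ops mul inv e.
Proof.
exists (fun x y => A AGGroup.Mul (pair_fun x y)),
  (fun x => A AGGroup.Inv (fun=> x)), (A AGGroup.E (fun=> g0)).
apply: functional_extensionality_dep => -[];
  apply: functional_extensionality => v /=.
- by rewrite {1}(pair_funE v).
- by rewrite {1}(const_funE v).
- by rewrite (empty_funE v (fun=> g0)).
Qed.

Lemma Q_opsP (G : Type) (A : operations AGss_quasigroups G) :
  exists mul rdiv ldiv, A = Q_ops mul rdiv ldiv.
Proof.
exists (fun x y => A AGssQuasigroup.Mul (pair_fun x y)),
  (fun x y => A AGssQuasigroup.RDiv (pair_fun x y)),
  (fun x y => A AGssQuasigroup.LDiv (pair_fun x y)).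
by apply: functional_extensionality_dep => -[];
  apply: functional_extensionality => v /=; rewrite {1}(pair_funE v).
Qed.

Lemma M_opsP (G : Type) (g0 : G) (A : operations Zx_x2m1_modules G) :
  exists add opp zero phi, A = M_ops add opp zero phi.
Proof.
exists (fun x y => A InvolutoryModule.Add (pair_fun x y)),
  (fun x => A InvolutoryModule.Opp (fun=> x)),
  (A InvolutoryModule.Zero (fun=> g0)),
  (fun x => A InvolutoryModule.Phi (fun=> x)).
apply: functional_extensionality_dep => -[];
  apply: functional_extensionality => v /=.
- by rewrite {1}(pair_funE v).
- by rewrite {1}(const_funE v).
- by rewrite (empty_funE v (fun=> g0)).
- by rewrite {1}(const_funE v).
Qed.

Definition valuation3 (G : Type) (a b c : G) (n : nat) : G :=
  match n with 0 => a | 1 => b | _ => c end.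

(** On curried operations, evaluating an identity computes to the corresponding equation, so both
    directions hold by conversion. The identities use variables 0, 1 and 2 only, hence [valuation3]
    suffices. *)
Lemma satisfies_AG (G : Type) (mul : G -> G -> G) (inv : G -> G) (e : G) :
  satisfies (AG_ops mul inv e) <-> is_AG_group mul inv e.
Proof.
split=> [sat|[H1 H2 H3 H4]]; last first.
  move=> s t [] v; [exact: H1|exact: H2|exact: H3|exact: H4].
split=> [a b c|a|a|a].
- exact: sat _ _ AGGroup.left_invertive (valuation3 a b c).
- exact: sat _ _ AGGroup.mul_inv_r (valuation3 a a a).
- exact: sat _ _ AGGroup.mul_inv_l (valuation3 a a a).
- exact: sat _ _ AGGroup.mul_e_l (valuation3 a a a).
Qed.

Lemma satisfies_Q (G : Type) (mul rdiv ldiv : G -> G -> G) :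
  satisfies (Q_ops mul rdiv ldiv) <-> is_AGss_quasigroup mul rdiv ldiv.
Proof.
split=> [sat|[H1 H2 H3 H4 H5 H6]]; last first.
  move=> s t [] v; [exact: H1|exact: H2|exact: H3|exact: H4|exact: H5|exact: H6].
split=> [a b c|a b c|a b|a b|a b|a b].
- exact: sat _ _ AGssQuasigroup.left_invertive (valuation3 a b c).
- exact: sat _ _ AGssQuasigroup.ag_star_star (valuation3 a b c).
- exact: sat _ _ AGssQuasigroup.mul_ldiv (valuation3 a b b).
- exact: sat _ _ AGssQuasigroup.ldiv_mul (valuation3 a b b).
- exact: sat _ _ AGssQuasigroup.rdiv_mul (valuation3 a b b).
- exact: sat _ _ AGssQuasigroup.mul_rdiv (valuation3 a b b).
Qed.

Lemma satisfies_M (G : Type) (add : G -> G -> G) (opp : G -> G) (zero : G)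
    (phi : G -> G) :
  satisfies (M_ops add opp zero phi) <-> is_involutory_module add opp zero phi.
Proof.
split=> [sat|[H1 H2 H3 H4 H5 H6]]; last first.
  move=> s t [] v; [exact: H1|exact: H2|exact: H3|exact: H4|exact: H5|exact: H6].
split=> [a b c|a b|a|a|a b|a].
- exact: sat _ _ InvolutoryModule.addA (valuation3 a b c).
- exact: sat _ _ InvolutoryModule.addC (valuation3 a b b).
- exact: sat _ _ InvolutoryModule.add0 (valuation3 a a a).
- exact: sat _ _ InvolutoryModule.addN (valuation3 a a a).
- exact: sat _ _ InvolutoryModule.phiD (valuation3 a b b).
- exact: sat _ _ InvolutoryModule.phiK (valuation3 a a a).
Qed.

(** * The translations *)

(** Variables are written with the very [widen_ord] of [interpreted_by], so
    that interpreting the terms below holds by computation. *)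
Definition arg (S : signature) (n : nat) (i : 'I_n) : term S 'I_(maxn 1 n) :=
  Var (widen_ord (leq_maxr 1 n) i).

Definition AG_mul (X : Type) (s t : term AGGroup.S X) : term AGGroup.S X :=
  @app AGGroup.S X AGGroup.Mul [tuple s; t].
Definition AG_inv (X : Type) (s : term AGGroup.S X) : term AGGroup.S X :=
  @app AGGroup.S X AGGroup.Inv [tuple s].
Definition AG_e (X : Type) : term AGGroup.S X :=
  @app AGGroup.S X AGGroup.E [tuple].

Definition Q_mul (X : Type) (s t : term AGssQuasigroup.S X) :
  term AGssQuasigroup.S X := @app AGssQuasigroup.S X AGssQuasigroup.Mul [tuple s; t].
Definition Q_rdiv (X : Type) (s t : term AGssQuasigroup.S X) :
  term AGssQuasigroup.S X := @app AGssQuasigroup.S X AGssQuasigroup.RDiv [tuple s; t].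

Definition M_add (X : Type) (s t : term InvolutoryModule.S X) :
  term InvolutoryModule.S X :=
  @app InvolutoryModule.S X InvolutoryModule.Add [tuple s; t].
Definition M_opp (X : Type) (s : term InvolutoryModule.S X) :
  term InvolutoryModule.S X :=
  @app InvolutoryModule.S X InvolutoryModule.Opp [tuple s].
Definition M_zero (X : Type) : term InvolutoryModule.S X :=
  @app InvolutoryModule.S X InvolutoryModule.Zero [tuple].
Definition M_phi (X : Type) (s : term InvolutoryModule.S X) :
  term InvolutoryModule.S X :=
  @app InvolutoryModule.S X InvolutoryModule.Phi [tuple s].

Definition Q_in_AG : translation AG_groups AGss_quasigroups :=
  fun g => let x := @arg AGGroup.S 2 ord0 in let y := @arg AGGroup.S 2 ord_max in
  match g with
  | AGssQuasigroup.Mul => AG_mul x y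
  | AGssQuasigroup.RDiv => AG_mul x (AG_inv y)
  | AGssQuasigroup.LDiv => AG_mul (AG_mul (AG_inv x) (AG_e _)) y
  end.

(** The quasigroup signature has no closed terms, so the unit is assigned the one-variable term
    [x / x]. *)
Definition AG_in_Q : translation AGss_quasigroups AG_groups :=
  fun g => match g return term _ 'I_(maxn 1 (@arity AGGroup.S g)) with
  | AGGroup.Mul => Q_mul (@arg AGssQuasigroup.S 2 ord0) (@arg AGssQuasigroup.S 2 ord_max)
  | AGGroup.Inv => let x := @arg AGssQuasigroup.S 1 ord0 in Q_rdiv (Q_rdiv x x) x
  | AGGroup.E => Q_rdiv (Var ord0) (Var ord0)
  end.

Definition M_in_AG : translation AG_groups Zx_x2m1_modules :=
  fun g => match g return term _ 'I_(maxn 1 (@arity InvolutoryModule.S g)) with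
  | InvolutoryModule.Add =>
      AG_mul (AG_mul (@arg AGGroup.S 2 ord0) (AG_e _)) (@arg AGGroup.S 2 ord_max)
  | InvolutoryModule.Opp => AG_inv (AG_mul (@arg AGGroup.S 1 ord0) (AG_e _))
  | InvolutoryModule.Zero => AG_e _
  | InvolutoryModule.Phi => AG_mul (@arg AGGroup.S 1 ord0) (AG_e _)
  end.

Definition AG_in_M : translation Zx_x2m1_modules AG_groups :=
  fun g => match g return term _ 'I_(maxn 1 (@arity AGGroup.S g)) with
  | AGGroup.Mul =>
      M_add (M_phi (@arg InvolutoryModule.S 2 ord0)) (@arg InvolutoryModule.S 2 ord_max)
  | AGGroup.Inv => M_opp (M_phi (@arg InvolutoryModule.S 1 ord0))
  | AGGroup.E => M_zero _
  end.

(** * The two equivalences with AG-groups, and their composite *)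

Lemma AG_Q_equivalent : term_equivalent AG_groups AGss_quasigroups.
Proof.
exists Q_in_AG, AG_in_Q; split=> G [g0] A.
- have [mul [inv [e ->]]] := AG_opsP g0 A => /satisfies_AG AG.
  exists (Q_ops mul (fun a b => mul a (inv b)) (fun a b => mul (mul (inv a) e) b)).
    by case.
  by apply/satisfies_Q/AGss_quasigroup_of_AG_group.
- have [mul [rdiv [ldiv ->]]] := Q_opsP A => /satisfies_Q Q.
  (* The unit is computed at the available point [g0]; [q_divxx] then matches it with the value at
     any other point. *)
  exists (AG_ops mul (fun a => rdiv (rdiv a a) a) (rdiv g0 g0)).
    by case=> v //; apply: q_divxx Q _ _.
  by apply/satisfies_AG/(AG_group_of_AGss_quasigroup Q).
- move=> B; have [mul [inv [e ->]]] := AG_opsP g0 A.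
  have [qmul [rdiv [ldiv ->]]] := Q_opsP B => /satisfies_AG AG H.
  (* Evaluating [H] at standard tuples expresses the operations of [B] by those of [A]. *)
  have mulE x y : qmul x y = mul x y := H AGssQuasigroup.Mul (pair_fun x y).
  have rdivE x y : rdiv x y = mul x (inv y) := H AGssQuasigroup.RDiv (pair_fun x y).
  case=> v /=.
  + by rewrite mulE.
  (* The inverse is recovered from [(x / x) / x], which is [e * inv x]. *)
  + by rewrite !rdivE (ag_mulxV AG) (ag_mul1x AG).
  + by rewrite !rdivE (ag_mulxV AG).
- move=> B; have [mul [rdiv [ldiv ->]]] := Q_opsP A.
  have [gmul [inv [e ->]]] := AG_opsP g0 B => /satisfies_Q Q H.
  have mulE x y : gmul x y = mul x y := H AGGroup.Mul (pair_fun x y).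
  have invE x : inv x = rdiv (rdiv x x) x := H AGGroup.Inv (fun=> x).
  have eE : e = rdiv g0 g0 := H AGGroup.E (fun=> g0).
  have AG := AG_group_of_AGss_quasigroup Q g0.
  case=> v /=; rewrite ?mulE ?invE ?eE //.
  (* Each division is recovered by multiplying the candidate by the divisor and dividing back; the
     product collapses by the AG-group laws. *)
  + by rewrite -[RHS](q_mul_rdiv Q (v (widen_ord (leq_maxr 1 2) ord_max)))
      (ag_mulVK AG).
  + set x := v _; set y := v _; rewrite -[RHS](q_ldiv_mul Q x).
    by rewrite (ag_mulCA AG) (ag_V1_mulK AG).
Qed.

Lemma AG_M_equivalent : term_equivalent AG_groups Zx_x2m1_modules.
Proof.
exists M_in_AG, AG_in_M; split=> G [g0] A.
- have [mul [inv [e ->]]] := AG_opsP g0 A => /satisfies_AG AG.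
  exists (M_ops (fun a b => mul (mul a e) b) (fun a => inv (mul a e)) e
           (fun a => mul a e)).
    by case.
  by apply/satisfies_M/involutory_module_of_AG_group.
- have [add [opp [zero [phi ->]]]] := M_opsP g0 A => /satisfies_M M.
  exists (AG_ops (fun a b => add (phi a) b) (fun a => opp (phi a)) zero).
    by case.
  by apply/satisfies_AG/AG_group_of_involutory_module.
- move=> B; have [mul [inv [e ->]]] := AG_opsP g0 A.
  have [add [opp [zero [phi ->]]]] := M_opsP g0 B => /satisfies_AG AG H.
  have addE x y : add x y = mul (mul x e) y :=
    H InvolutoryModule.Add (pair_fun x y).
  have oppE x : opp x = inv (mul x e) := H InvolutoryModule.Opp (fun=> x).
  have zeroE : zero = e := H InvolutoryModule.Zero (fun=> g0).
  have phiE x : phi x = mul x e := H InvolutoryModule.Phi (fun=> x).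
  (* What remains is [(xe)e = x], for instance in [add (phi x) y = ((xe)e)y]. *)
  by case=> v /=; rewrite ?addE ?oppE ?phiE ?(ag_mulxx1 AG).
- move=> B; have [add [opp [zero [phi ->]]]] := M_opsP g0 A.
  have [mul [inv [e ->]]] := AG_opsP g0 B => /satisfies_M M H.
  have mulE x y : mul x y = add (phi x) y := H AGGroup.Mul (pair_fun x y).
  have invE x : inv x = opp (phi x) := H AGGroup.Inv (fun=> x).
  have eE : e = zero := H AGGroup.E (fun=> g0).
  by case=> v /=; rewrite ?invE ?mulE eE ?(m_addx0 M) ?(m_phiK M).
Qed.

Theorem theorem2p2 :
  term_equivalent AG_groups AGss_quasigroups /\
  term_equivalent AGss_quasigroups Zx_x2m1_modules /\
  term_equivalent AG_groups Zx_x2m1_modules.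
Proof.
split; first exact: AG_Q_equivalent.
split; last exact: AG_M_equivalent.
exact: term_equivalent_trans (term_equivalent_sym AG_Q_equivalent) AG_M_equivalent.
Qed.
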